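(* The open prime filter monad $\mathbb{F}=(F,\mu,\eta)$ on $\mathbf{Top}$ is induced by the adjunction $\mathcal{O}\dashv\Sigma$ (between $\mathbf{Top}$ and $\mathbf{Frm}^{op}$) from the ideal frame comonad $\mathbb{K}$ on $\mathbf{Frm}$. That is, regarding $\mathbb{K}$ as a monad on $\mathbf{Frm}^{op}$ with underlying functor $\mathfrak{I}$, the monad on $\mathbf{Top}$ with underlying functor $\Sigma\cdot\mathfrak{I}\cdot\mathcal{O}$ induced by $\mathcal{O}\dashv\Sigma$ is (isomorphic to) $\mathbb{F}$.
   Context: $\mathbf{Frm}$ is the category of frames and frame homomorphisms. $\mathcal{O}:\mathbf{Top}\to\mathbf{Frm}^{op}$ sends a space to its frame of open sets and a continuous map $f$ to $f^{-1}[-]$. Its right adjoint $\Sigma:\mathbf{Frm}^{op}\to\mathbf{Top}$ sends a frame $L$ to the set of frame homomorphisms $f:L\to 2=\{0<1\}$, with open sets $\Sigma_a=\{f\mid f(a)=1\}$, $a\in L$. The monad $\mathbb{F}=(F,\mu,\eta)$ on $\mathbf{Top}$ is the one induced by the adjunction $\mathbf{Top}(-,2)\dashv\mathbf{DLat}(-,2):\mathbf{DLat}^{op}\to\mathbf{Top}$, where $\mathbf{DLat}$ is the category of bounded distributive lattices and $2$ denotes both the Sierpiński space and the two-element lattice. Explicitly, for a space $(X,\tau)$, $FX$ is the set of prime filters of the lattice $\tau$, with basis of open sets $O^{*}=\{p\in FX\mid O\in p\}$ ($O\in\tau$); $\mu(\mathfrak{X})=\{O\in\tau\mid O^{*}\in\mathfrak{X}\}$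 and $\eta(x)=\{O\in\tau\mid x\in O\}$. For a bounded distributive lattice $D$, $\mathfrak{I}D$ is the frame of ideals of $D$ (downsets closed under finite joins), and for a lattice homomorphism $f$, $\mathfrak{I}f(I)=\{b\mid b\le f(a)\text{ for some }a\in I\}$. This functor $\mathbf{DLat}\to\mathbf{Frm}$ is left adjoint to the forgetful functor, with unit $\downarrow(a)=\{x\mid x\le a\}$. The comonad $\mathbb{K}$ on $\mathbf{Frm}$ is the one induced by this adjunction: its underlying functor is $\mathfrak{I}$, its comultiplication is $c=\mathfrak{I}(\downarrow):\mathfrak{I}L\to\mathfrak{I}\mathfrak{I}L$, $I\mapsto\{J\mid\bigvee J\in I\}$, and its counit is the join map $\mathfrak{I}L\to L$, $I\mapsto\bigvee I$. Given an adjunction $L\dashv R$ with $R:\mathbf{C}\to\mathbf{B}$, unit $\eta'$ and counit $\epsilon$, and a monad $(T,m,e)$ on $\mathbf{C}$, the induced monad on $\mathbf{B}$ has functor $RTL$, multiplication $RmL\cdot RT\epsilon TL$ and unit $ReL\cdot\eta'$. *)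

(* Defs.v *)
Set Warnings "-notation-overridden".
From HB Require Import structures.
From mathcomp Require Import all_boot all_order.
From mathcomp Require Import boolp classical_sets topology.

Set Implicit Arguments.
Unset Strict Implicit.
Unset Printing Implicit Defensive.

Record category := Category {
  obj :> Type;
  hom : obj -> obj -> Type;
  idm : forall a, hom a a;
  compm : forall a b c, hom b c -> hom a b -> hom a c;
  compmA : forall a b c d (h : hom c d) (g : hom b c) (f : hom a b),
    compm h (compm g f) = compm (compm h g) f;
  comp1m : forall a b (f : hom a b), compm (idm b) f = f;
  compm1 : forall a b (f : hom a b), compm f (idm a) = f
}.
Arguments hom {C} : rename.
Arguments idm {C} : rename.
Arguments compm {C a b c} : rename.

Declare Scope cat_scope.
Delimit Scope cat_scope with cat.
Local Open Scope cat_scope.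
Notation "g ∘ f" := (compm g f)
  (at level 40, left associativity, format "g  ∘  f") : cat_scope.

Definition opcat (C : category) : category := {|
  obj := C;
  hom a b := @hom C b a;
  idm a := idm a;
  compm a b c g f := f ∘ g;
  compmA a b c d h g f := esym (compmA f g h);
  comp1m a b f := compm1 f;
  compm1 a b f := comp1m f
|}.

Record functor (C D : category) := Functor {
  fobj :> C -> D;
  fmap : forall a b : C, hom a b -> hom (fobj a) (fobj b);
  fmap1 : forall a, fmap (idm a) = idm (fobj a);
  fmapM : forall (a b c : C) (g : hom b c) (f : hom a b),
    fmap (g ∘ f) = fmap g ∘ fmap f
}.
Arguments fmap {C D} F {a b} : rename.

Definition idfunctor (C : category) : functor C C :=
  @Functor C C id (fun _ _ => id) (fun _ => erefl) (fun _ _ _ _ _ => erefl).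

#[local] Obligation Tactic := idtac.

Program Definition compfunctor (B C D : category)
    (G : functor C D) (F : functor B C) : functor B D :=
  @Functor B D (fun a => G (F a)) (fun _ _ f => fmap G (fmap F f)) _ _.
Next Obligation. by move=> B C D G F a; rewrite /= !fmap1. Qed.
Next Obligation. by move=> B C D G F a b c g f; rewrite /= !fmapM. Qed.

Definition opfunctor (C D : category) (F : functor C D) :
    functor (opcat C) (opcat D) :=
  @Functor (opcat C) (opcat D) F (fun a b f => @fmap C D F b a f)
    (@fmap1 C D F) (fun a b c g f => @fmapM C D F c b a f g).

Record nattrans (C D : category) (F G : functor C D) := NatTrans {
  component :> forall a, hom (F a) (G a);
  naturality : forall (a b : C) (f : hom a b),
    component b ∘ fmap F f = fmap G f ∘ component a
}.

(* L is the left adjoint. *)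
Record adjunction (B C : category) (L : functor B C) (R : functor C B) :=
  Adjunction {
    adj_unit : nattrans (idfunctor B) (compfunctor R L);
    adj_counit : nattrans (compfunctor L R) (idfunctor C);
    triangleL : forall b, adj_counit (L b) ∘ fmap L (adj_unit b) = idm (L b);
    triangleR : forall c, fmap R (adj_counit c) ∘ adj_unit (R c) = idm (R c)
  }.

Record monad (C : category) := Monad {
  mfun :> functor C C;
  mult : nattrans (compfunctor mfun mfun) mfun;
  ret : nattrans (idfunctor C) mfun;
  mult_ret : forall a, mult a ∘ ret (mfun a) = idm (mfun a);
  mult_mapret : forall a, mult a ∘ fmap mfun (ret a) = idm (mfun a);
  multA : forall a,
    mult a ∘ fmap mfun (mult a) = mult a ∘ mult (mfun a)
}.

Record comonad (C : category) := Comonad {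
  wfun :> functor C C;
  comult : nattrans wfun (compfunctor wfun wfun);
  extract : nattrans wfun (idfunctor C);
  extract_comult : forall a, extract (wfun a) ∘ comult a = idm (wfun a);
  mapextract_comult : forall a,
    fmap wfun (extract a) ∘ comult a = idm (wfun a);
  comultA : forall a,
    fmap wfun (comult a) ∘ comult a = comult (wfun a) ∘ comult a
}.

Program Definition monad_of_comonad (C : category) (W : comonad C) :
    monad (opcat C) :=
  @Monad (opcat C) (opfunctor W)
    (@NatTrans (opcat C) (opcat C) _ (opfunctor W) (fun a => comult W a) _)
    (@NatTrans (opcat C) (opcat C) (idfunctor _) (opfunctor W)
      (fun a => extract W a) _)
    _ _ _.
Next Obligation. by move=> C W a b f; exact: (esym (naturality (comult W) f)). Qed.
Next Obligation. by move=> C W a b f; exact: (esym (naturality (extract W) f)). Qed.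
Next Obligation. by move=> C W a; exact: extract_comult. Qed.
Next Obligation. by move=> C W a; exact: mapextract_comult. Qed.
Next Obligation. by move=> C W a; exact: comultA. Qed.

Section AdjunctionTheory.
Variables (B C : category) (L : functor B C) (R : functor C B).
Variable A : adjunction L R.

(* Functor LR, comultiplication L(unit R), counit that of the adjunction. *)
Program Definition comonad_of_adjunction : comonad C :=
  @Comonad C (compfunctor L R)
    (@NatTrans _ _ (compfunctor L R)
      (compfunctor (compfunctor L R) (compfunctor L R))
      (fun c => fmap L (adj_unit A (R c))) _)
    (adj_counit A) _ _ _.
Next Obligation.
by move=> a b f /=; rewrite -!fmapM; congr fmap; exact: (naturality (adj_unit A)).
Qed.
Next Obligation. by move=> c; exact: (triangleL A). Qed.
Next Obligation. by move=> c /=; rewrite -fmapM (triangleR A) fmap1. Qed.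
Next Obligation.
move=> c /=; rewrite -!fmapM; congr fmap.
exact: esym (naturality (adj_unit A) (adj_unit A (R c))).
Qed.

Variable T : monad C.

(* Functor RTL, multiplication R m L . R T counit T L, unit R e L . unit. *)
Program Definition induced_monad : monad B :=
  @Monad B (compfunctor R (compfunctor T L))
    (@NatTrans _ _
      (compfunctor (compfunctor R (compfunctor T L))
                   (compfunctor R (compfunctor T L))) _
      (fun b => fmap R (mult T (L b)) ∘ fmap R (fmap T (adj_counit A (T (L b))))) _)
    (@NatTrans _ _ (idfunctor B) _
      (fun b => fmap R (ret T (L b)) ∘ adj_unit A b) _)
    _ _ _.
Next Obligation.
move=> a b f /=; rewrite -!fmapM; congr fmap.
rewrite -compmA -fmapM (naturality (adj_counit A) (fmap T (fmap L f))) /=.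
by rewrite fmapM !compmA; congr (_ ∘ _); exact: (naturality (mult T)).
Qed.
Next Obligation.
move=> a b f /=; rewrite -compmA (naturality (adj_unit A) f) /= !compmA -!fmapM.
by rewrite (naturality (ret T) (fmap L f)).
Qed.
Next Obligation.
move=> b /=; set e := adj_counit A (T (L b)).
rewrite -fmapM compmA -fmapM.
rewrite -compmA -(naturality (ret T) e) compmA mult_ret comp1m.
exact: (triangleR A).
Qed.
Next Obligation.
move=> b /=; rewrite -!fmapM -fmap1; congr fmap.
have E := naturality (adj_counit A) (ret T (L b)); rewrite /= in E.
rewrite -compmA -fmapM [fmap L _]fmapM compmA E -compmA (triangleL A) compm1.
exact: mult_mapret.
Qed.
Next Obligation.
move=> b /=; rewrite -!fmapM; congr fmap.
set m := mult T (L b); set e := adj_counit A (T (L b)).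
have E1 := naturality (adj_counit A) (m ∘ fmap T e); rewrite /= in E1.
rewrite -compmA -fmapM E1 !fmapM !compmA multA.
congr (_ ∘ _); rewrite -!compmA; congr (_ ∘ _).
exact: (naturality (mult T) e).
Qed.

End AdjunctionTheory.

Definition is_iso (C : category) (a b : C) (f : hom a b) :=
  exists g : hom b a, g ∘ f = idm a /\ f ∘ g = idm b.

(* Isomorphism of monads on a fixed category: a natural isomorphism of the
   underlying functors compatible with units and multiplications. *)
Definition monad_isomorphic (C : category) (M N : monad C) :=
  exists alpha : nattrans M N,
    [/\ forall a, is_iso (alpha a),
        forall a, alpha a ∘ ret M a = ret N a
      & forall a, alpha a ∘ mult M a =
          mult N a ∘ (alpha (N a) ∘ fmap M (alpha a))].

Import Order.TTheory.
Local Open Scope classical_set_scope.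
Local Open Scope order_scope.

HB.mixin Record isFrame d T of Order.TBDistrLattice d T := {
  bigjoin : set T -> T;
  bigjoin_ub : forall (A : set T) x, A x -> x <= bigjoin A;
  bigjoin_le : forall (A : set T) y,
    (forall x, A x -> x <= y) -> bigjoin A <= y;
  meet_bigjoin : forall x (A : set T),
    x `&` bigjoin A = bigjoin [set x `&` y | y in A]
}.

#[short(type="frameType")]
HB.structure Definition Frame d :=
  {T of isFrame d T & Order.TBDistrLattice d T}.

(* The library's {tblmorphism _ -> _} preserves only \bot and \top and its
   {lmorphism _ -> _} only binary meets and joins: bounded lattice
   homomorphisms need both. *)
HB.structure Definition DLatMorphism d (D : tbDistrLatticeType d)
    d' (D' : tbDistrLatticeType d') :=
  {f of @Order.LatticeMorphism d D d' D' f & @Order.TBLatticeMorphism d D d' D' f}.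

Reserved Notation "'{' 'dlmorphism' U '->' V '}'"
  (U at level 98, V at level 99, format "{ 'dlmorphism'  U  ->  V }").
Notation "{ 'dlmorphism' T -> T' }" :=
  (@DLatMorphism.type _ T%type _ T'%type) : type_scope.

Section DLatMorphismInstances.
Variables (d d' d'' : Order.disp_t) (D : tbDistrLatticeType d).
Variables (D' : tbDistrLatticeType d') (D'' : tbDistrLatticeType d'').
Variables (g : {dlmorphism D' -> D''}) (f : {dlmorphism D -> D'}).

HB.instance Definition _ := Order.BLatticeMorphism.on (@idfun D).
HB.instance Definition _ := Order.BLatticeMorphism.on (g \o f).

End DLatMorphismInstances.

HB.mixin Record isBigJoinMorphism d (L : frameType d) d' (M : frameType d')
    (f : L -> M) := {
  fmorph_bigjoin : forall A : set L, f (bigjoin A) = bigjoin (f @` A)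
}.

HB.structure Definition FrameMorphism d (L : frameType d) d' (M : frameType d') :=
  {f of @DLatMorphism d L d' M f & isBigJoinMorphism d L d' M f}.

Reserved Notation "'{' 'fmorphism' U '->' V '}'"
  (U at level 98, V at level 99, format "{ 'fmorphism'  U  ->  V }").
Notation "{ 'fmorphism' T -> T' }" :=
  (@FrameMorphism.type _ T%type _ T'%type) : type_scope.

Section FrameTheory.
Variables (d : Order.disp_t) (L : frameType d).
Implicit Types (x y : L) (A : set L).

Lemma bigjoinP A y : bigjoin A <= y <-> (forall x, A x -> x <= y).
Proof.
split=> [le_y x Ax|]; last exact: bigjoin_le.
exact: le_trans (bigjoin_ub _ _ Ax) le_y.
Qed.

Lemma bigjoin_unique A y : (forall x, A x -> x <= y) ->
  (forall z, (forall x, A x -> x <= z) -> y <= z) -> bigjoin A = y.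
Proof.
move=> uby leasty; apply/le_anti/andP; split; first exact/bigjoinP.
by apply: leasty; exact: bigjoin_ub.
Qed.

Lemma bigjoin0 : bigjoin (@set0 L) = \bot.
Proof. by apply: bigjoin_unique => // z _; exact: le0x. Qed.

Lemma bigjoin2 x y : bigjoin [set x; y] = x `|` y.
Proof.
apply: bigjoin_unique => [z [->|->]|z ub]; rewrite ?leUl ?leUr //.
by rewrite leUx !ub //; [right|left].
Qed.

Lemma le_bigjoin A B : (forall x, A x -> exists2 y, B y & x <= y) ->
  bigjoin A <= bigjoin B.
Proof.
move=> AB; apply/bigjoinP => x /AB[y By xy].
exact: le_trans xy (bigjoin_ub _ _ By).
Qed.

End FrameTheory.

(* A frame homomorphism is a map preserving finite meets and all joins. *)
HB.factory Record isFrameMorphism d (L : frameType d) d' (M : frameType d')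
    (f : L -> M) := {
  fmorph1 : f \top = \top;
  fmorphI : {morph f : x y / x `&` y};
  fmorph_bigjoin : forall A : set L, f (bigjoin A) = bigjoin (f @` A)
}.

HB.builders Context d L d' M f of isFrameMorphism d L d' M f.

Let f_le : {homo f : x y / x <= y}.
Proof. by move=> x y /meet_idPl xy; rewrite -xy fmorphI leIr. Qed.

Let f_join : {morph f : x y / x `|` y}.
Proof. by move=> x y; rewrite -!bigjoin2 fmorph_bigjoin image_setU !image_set1. Qed.

Let f_bot : f \bot = \bot.
Proof. by rewrite -!bigjoin0 fmorph_bigjoin image_set0. Qed.

HB.instance Definition _ := Order.isOrderMorphism.Build d L d' M f f_le.
HB.instance Definition _ := Order.isMeetLatticeMorphism.Build d L d' M f fmorphI.
HB.instance Definition _ := Order.isJoinLatticeMorphism.Build d L d' M f f_join.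
HB.instance Definition _ := Order.isBLatticeMorphism.Build d L d' M f f_bot.
HB.instance Definition _ := Order.isTLatticeMorphism.Build d L d' M f fmorph1.
HB.instance Definition _ := isBigJoinMorphism.Build d L d' M f fmorph_bigjoin.
HB.end.

Lemma dlmorphP d (D : tbDistrLatticeType d) d' (D' : tbDistrLatticeType d')
  (f g : {dlmorphism D -> D'}) : f =1 g -> f = g.
Proof.
move=> fg; have {fg}: (f : D -> D') = g by exact/funext.
case: f g => f [[f1] [f2] [f3] [f4] [f5]] [g [[g1] [g2] [g3] [g4] [g5]]] /= fg.
by subst g; rewrite (Prop_irrelevance f1 g1) (Prop_irrelevance f2 g2)
  (Prop_irrelevance f3 g3) (Prop_irrelevance f4 g4) (Prop_irrelevance f5 g5).
Qed.

Lemma fmorphP d (L : frameType d) d' (M : frameType d')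
  (f g : {fmorphism L -> M}) : f =1 g -> f = g.
Proof.
move=> fg; have {fg}: (f : L -> M) = g by exact/funext.
case: f g => f [[f1] [f2] [f3] [f4] [f5] [f6]].
case=> g [[g1] [g2] [g3] [g4] [g5] [g6]] /= fg.
by subst g; rewrite (Prop_irrelevance f1 g1) (Prop_irrelevance f2 g2)
  (Prop_irrelevance f3 g3) (Prop_irrelevance f4 g4) (Prop_irrelevance f5 g5)
  (Prop_irrelevance f6 g6).
Qed.

Fact idfun_bigjoin d (L : frameType d) (A : set L) :
  idfun (bigjoin A) = bigjoin (idfun @` A).
Proof. by rewrite image_id. Qed.
HB.instance Definition _ d (L : frameType d) :=
  isBigJoinMorphism.Build d L d L idfun (@idfun_bigjoin d L).

Fact comp_bigjoin d (L : frameType d) d' (M : frameType d') d'' (N : frameType d'')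
  (g : {fmorphism M -> N}) (f : {fmorphism L -> M}) (A : set L) :
  (g \o f) (bigjoin A) = bigjoin ((g \o f) @` A).
Proof. by rewrite /= !fmorph_bigjoin image_comp. Qed.
HB.instance Definition _ d (L : frameType d) d' (M : frameType d')
    d'' (N : frameType d'') (g : {fmorphism M -> N}) (f : {fmorphism L -> M}) :=
  isBigJoinMorphism.Build d L d'' N (g \o f) (comp_bigjoin g f).

(* The display of an order structure is a printing tag; objects carry it
   because it indexes the library's types. *)
Record dlat := DLatOb { dlat_disp; dlat_sort :> tbDistrLatticeType dlat_disp }.
Record frm := FrmOb { frm_disp; frm_sort :> frameType frm_disp }.

Program Definition DLat : category := {|
  obj := dlat;
  hom D E := {dlmorphism D -> E};
  idm D := @idfun D : {dlmorphism D -> D};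
  compm D E F g f := (g \o f) : {dlmorphism D -> F}
|}.
Next Obligation. by move=> *; exact: dlmorphP. Qed.
Next Obligation. by move=> *; exact: dlmorphP. Qed.
Next Obligation. by move=> *; exact: dlmorphP. Qed.

Program Definition Frm : category := {|
  obj := frm;
  hom L M := {fmorphism L -> M};
  idm L := @idfun L : {fmorphism L -> L};
  compm L M N g f := (g \o f) : {fmorphism L -> N}
|}.
Next Obligation. by move=> *; exact: fmorphP. Qed.
Next Obligation. by move=> *; exact: fmorphP. Qed.
Next Obligation. by move=> *; exact: fmorphP. Qed.

Program Definition Top : category := {|
  obj := topologicalType;
  hom X Y := continuousType X Y;
  idm X := @idfun X : continuousType X X;
  compm X Y Z g f := (g \o f) : continuousType X Z
|}.
Next Obligation. by move=> *; exact/continuousEP. Qed.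
Next Obligation. by move=> *; exact/continuousEP. Qed.
Next Obligation. by move=> *; exact/continuousEP. Qed.

Fact bool_bigjoin_ub (A : set bool) x : A x -> x <= `[< A true >].
Proof. by case: x => // /asboolT ->. Qed.
Fact bool_bigjoin_le (A : set bool) y :
  (forall x, A x -> x <= y) -> (`[< A true >] : bool) <= y.
Proof. by move=> uby; case: asboolP => // /uby. Qed.
Fact bool_meet_bigjoin x (A : set bool) :
  x `&` `[< A true >] = `[< [set x `&` y | y in A] true >].
Proof.
apply/idP/asboolP => [/andP[-> /asboolP At]|[[] At]]; first by exists true.
  by rewrite /Order.meet/= andbT => ->; exact/asboolP.
by rewrite /Order.meet/= andbF.
Qed.
HB.instance Definition _ := isFrame.Build _ bool
  bool_bigjoin_ub bool_bigjoin_le bool_meet_bigjoin.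

Section Opens.
Variable X : topologicalType.

Record opens := Opens { opens_set :> set X; openP : open opens_set }.

HB.instance Definition _ := gen_eqMixin opens.
HB.instance Definition _ := gen_choiceMixin opens.

Implicit Types (U V W : opens) (A : set opens).

Lemma opens_eqP U V : (U : set X) = V -> U = V.
Proof.
by case: U V => U oU [V oV] /= UV; subst V; congr Opens; exact: Prop_irrelevance.
Qed.

Definition opens_le U V := `[< (U : set X) `<=` V >].
Definition opensI U V := Opens (openI (@openP U) (@openP V)).
Definition opensU U V := Opens (openU (@openP U) (@openP V)).
Definition opens0 := Opens (@open0 X).
Definition opensT := Opens (@openT X).
Definition opens_bigcup A :=
  Opens (@bigcup_open X _ A opens_set (fun U _ => @openP U)).

Fact opens_le_refl : reflexive opens_le.
Proof. by move=> U; exact/asboolP. Qed.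
Fact opens_le_anti : antisymmetric opens_le.
Proof.
by move=> U V /andP[/asboolP UV /asboolP VU]; apply/opens_eqP/seteqP.
Qed.
Fact opens_le_trans : transitive opens_le.
Proof.
move=> V U W /asboolP UV /asboolP VW; apply/asboolP; exact: subset_trans VW.
Qed.

Fact opens_display : Order.disp_t. Proof. by []. Qed.

HB.instance Definition _ := Order.Le_isPOrder.Build opens_display opens
  opens_le_refl opens_le_anti opens_le_trans.

Fact opens_meetP U V W : (U <= opensI V W) = (U <= V) && (U <= W).
Proof.
apply/asboolP/andP; rewrite /= subsetI.
  by move=> [UV UW]; split; exact/asboolP.
by move=> [/asboolP UV /asboolP UW].
Qed.
Fact opens_joinP U V W : (opensU U V <= W) = (U <= W) && (V <= W).
Proof.
apply/asboolP/andP; rewrite /= subUset.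
  by move=> [UW VW]; split; exact/asboolP.
by move=> [/asboolP UW /asboolP VW].
Qed.
HB.instance Definition _ := Order.POrder_MeetJoin_isLattice.Build
  opens_display opens opens_meetP opens_joinP.

Fact opens_meetUl : @left_distributive opens opens (@Order.meet _ _) (@Order.join _ _).
Proof. by move=> W U V; apply/opens_eqP; exact: setIUl. Qed.
HB.instance Definition _ := Order.Lattice_Meet_isDistrLattice.Build
  opens_display opens opens_meetUl.

Fact opens_le0x U : opens0 <= U. Proof. exact/asboolP. Qed.
HB.instance Definition _ := Order.hasBottom.Build opens_display opens opens_le0x.
Fact opens_lex1 U : U <= opensT. Proof. exact/asboolP. Qed.
HB.instance Definition _ := Order.hasTop.Build opens_display opens opens_lex1.

Fact opens_bigjoin_ub A U : A U -> U <= opens_bigcup A.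
Proof. by move=> AU; apply/asboolP; exact: bigcup_sup. Qed.
Fact opens_bigjoin_le A U : (forall V, A V -> V <= U) -> opens_bigcup A <= U.
Proof. by move=> ub; apply/asboolP; apply: bigcup_sub => V /ub /asboolP. Qed.
Fact opens_meet_bigjoin U A :
  U `&` opens_bigcup A = opens_bigcup [set U `&` V | V in A].
Proof. by apply: opens_eqP; rewrite /= bigcup_image setI_bigcupr. Qed.
HB.instance Definition _ := isFrame.Build opens_display opens
  opens_bigjoin_ub opens_bigjoin_le opens_meet_bigjoin.

End Opens.

Section OpensPreimage.
Variables (X Y : topologicalType) (f : continuousType X Y).

Fact preimage_openP (V : opens Y) : open (f @^-1` V).
Proof. by apply: open_comp (@openP _ V) => x _; exact: cts_fun. Qed.
Definition opens_preimage (V : opens Y) : opens X := Opens (preimage_openP V).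

Fact opens_preimage1 : opens_preimage \top = \top.
Proof. exact: opens_eqP. Qed.
Fact opens_preimageI : {morph opens_preimage : U V / U `&` V}.
Proof. by move=> U V; exact: opens_eqP. Qed.
Fact opens_preimage_bigjoin A :
  opens_preimage (bigjoin A) = bigjoin (opens_preimage @` A).
Proof. by apply: opens_eqP; rewrite /= bigcup_image preimage_bigcup. Qed.
HB.instance Definition _ := isFrameMorphism.Build _ (opens Y) _ (opens X)
  opens_preimage opens_preimage1 opens_preimageI opens_preimage_bigjoin.

End OpensPreimage.

Program Definition opens_functor : functor Top (opcat Frm) :=
  @Functor Top (opcat Frm) (fun X => FrmOb (opens X))
    (fun X Y f => opens_preimage f : {fmorphism opens Y -> opens X}) _ _.
Next Obligation. by move=> X; apply: fmorphP => U; exact: opens_eqP. Qed.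
Next Obligation. by move=> X Y Z g f; apply: fmorphP => U; exact: opens_eqP. Qed.

Section Points.
Variables (d : Order.disp_t) (L : frameType d).

Definition points := {fmorphism L -> bool}.

HB.instance Definition _ := gen_eqMixin points.
HB.instance Definition _ := gen_choiceMixin points.

Definition points_at (a : L) : set points := [set p | p a = true].

Fact points_at1 : points_at \top = setT.
Proof. by apply/seteqP; split=> // p _; exact: omorph1. Qed.
Fact points_atI a b : points_at (a `&` b) = (points_at a `&` points_at b)%classic.
Proof.
by apply/seteqP; split=> p; rewrite /points_at /= omorphI => /andP.
Qed.
Fact points_at_bigjoin A : points_at (bigjoin A) = \bigcup_(a in A) points_at a.
Proof.
apply/seteqP; split=> p; rewrite /points_at /= fmorph_bigjoin.
  by move=> /asboolP[a Aa pa]; exists a.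
by move=> [a Aa pa]; apply/asboolP; exists a.
Qed.

Fact points_openT : range points_at setT.
Proof. by exists \top => //; exact: points_at1. Qed.
Fact points_openI : setI_closed (range points_at).
Proof. by move=> _ _ [a _ <-] [b _ <-]; exists (a `&` b) => //; exact: points_atI. Qed.
Fact points_open_bigU (I : Type) (f : I -> set points) :
  (forall i, range points_at (f i)) -> range points_at (\bigcup_i f i).
Proof.
move=> fo; exists (bigjoin [set a | exists i, points_at a = f i]) => //.
rewrite points_at_bigjoin; apply/seteqP; split=> p.
  by move=> [a [i ai] pa]; exists i => //; rewrite -ai.
by move=> [i _ fip]; have [a _ ai] := fo i; exists a; [exists i | rewrite ai].
Qed.
HB.instance Definition _ := isOpenTopological.Build points
  points_openT points_openI points_open_bigU.

Lemma points_at_open a : open (points_at a).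
Proof. by exists a. Qed.

End Points.

Lemma continuous_openP (X Y : topologicalType) (f : X -> Y) :
  (forall V, open V -> open (f @^-1` V)) -> continuous f.
Proof. by move=> fo; apply/continuousP. Qed.

Section PointsMap.
Variables (d d' : Order.disp_t) (L : frameType d) (M : frameType d').
Variable h : {fmorphism M -> L}.

Definition points_map (p : points L) : points M := p \o h.

Fact points_map_cts : continuous points_map.
Proof.
by apply: continuous_openP => _ [a _ <-]; exists (h a).
Qed.
HB.instance Definition _ := isContinuous.Build (points L) (points M) points_map
  points_map_cts.

End PointsMap.

(* points L is the space of frame homomorphisms L -> 2, with open sets
   exactly the sets points_at a. *)
Program Definition points_functor : functor (opcat Frm) Top :=
  @Functor (opcat Frm) Top (fun L => points L)
    (fun L M h => points_map h : continuousType (points L) (points M)) _ _.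
Next Obligation. by move=> L; apply/continuousEP => p; exact: fmorphP. Qed.
Next Obligation. by move=> L M N g f; apply/continuousEP => p; exact: fmorphP. Qed.

Section OpensPointsUnit.
Variable X : topologicalType.

(* The unit at X sends x to the frame homomorphism U |-> (x \in U). *)
Definition nbhd_point_fun (x : X) (U : opens X) : bool := `[< (U : set X) x >].

Fact nbhd_point_fun1 x : nbhd_point_fun x \top = \top.
Proof. exact/asboolP. Qed.
Fact nbhd_point_funI x : {morph nbhd_point_fun x : U V / U `&` V}.
Proof. by move=> U V; exact: asbool_and. Qed.
Fact nbhd_point_fun_bigjoin x A :
  nbhd_point_fun x (bigjoin A) = bigjoin (nbhd_point_fun x @` A).
Proof.
apply/asboolP/asboolP => [[U AU Ux]|[U AU /asboolP Ux]]; last by exists U.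
by exists U => //; exact/asboolP.
Qed.
HB.instance Definition _ x := isFrameMorphism.Build _ (opens X) _ bool
  (nbhd_point_fun x) (nbhd_point_fun1 x) (@nbhd_point_funI x)
  (@nbhd_point_fun_bigjoin x).

Definition nbhd_point (x : X) : points (opens X) := nbhd_point_fun x.

Fact nbhd_point_cts : continuous nbhd_point.
Proof.
apply: continuous_openP => _ [U _ <-].
suff -> : nbhd_point @^-1` points_at U = U by exact: openP.
by apply/seteqP; split=> x /asboolP.
Qed.
HB.instance Definition _ := isContinuous.Build X (points (opens X)) nbhd_point
  nbhd_point_cts.

End OpensPointsUnit.

Section OpensPointsCounit.
Variables (d : Order.disp_t) (L : frameType d).

Definition open_points_at (a : L) : opens (points L) := Opens (points_at_open a).

Fact open_points_at1 : open_points_at \top = \top.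
Proof. by apply: opens_eqP; exact: points_at1. Qed.
Fact open_points_atI : {morph open_points_at : a b / a `&` b}.
Proof. by move=> a b; apply: opens_eqP; exact: points_atI. Qed.
Fact open_points_at_bigjoin A :
  open_points_at (bigjoin A) = bigjoin (open_points_at @` A).
Proof.
by apply: opens_eqP; rewrite /= bigcup_image; exact: points_at_bigjoin.
Qed.
HB.instance Definition _ := isFrameMorphism.Build _ L _ (opens (points L))
  open_points_at open_points_at1 open_points_atI open_points_at_bigjoin.

End OpensPointsCounit.

Program Definition opens_points_adjunction :
    adjunction opens_functor points_functor :=
  @Adjunction Top (opcat Frm) opens_functor points_functor
    (@NatTrans Top Top (idfunctor Top) (compfunctor points_functor opens_functor)
      (fun X => @nbhd_point X : continuousType X (points (opens X))) _)
    (@NatTrans (opcat Frm) (opcat Frm)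
      (compfunctor opens_functor points_functor) (idfunctor (opcat Frm))
      (fun L => @open_points_at _ L : {fmorphism L -> opens (points L)}) _)
    _ _.
Next Obligation.
by move=> X Y f; apply/continuousEP => x; exact: fmorphP.
Qed.
Next Obligation.
by move=> L M f; apply: fmorphP => a; exact: opens_eqP.
Qed.
Next Obligation.
move=> X; apply: fmorphP => U; apply: opens_eqP.
by apply/seteqP; split=> x /asboolP.
Qed.
Next Obligation.
move=> L; apply/continuousEP => p; apply: fmorphP => a.
by rewrite /= /nbhd_point_fun /=; apply/asboolP/idP.
Qed.

Section Ideals.
Variables (d : Order.disp_t) (D : tbDistrLatticeType d).

Record ideal := Ideal {
  ideal_set :> set D;
  ideal0 : ideal_set \bot;
  idealU : forall a b, ideal_set a -> ideal_set b -> ideal_set (a `|` b);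
  ideal_down : forall a b, b <= a -> ideal_set a -> ideal_set b
}.

HB.instance Definition _ := gen_eqMixin ideal.
HB.instance Definition _ := gen_choiceMixin ideal.

Implicit Types (I J K : ideal) (A : set ideal).

Lemma ideal_eqP I J : (I : set D) = J -> I = J.
Proof.
case: I J => I I1 I2 I3 [J J1 J2 J3] /= IJ; subst J.
by rewrite (Prop_irrelevance I1 J1) (Prop_irrelevance I2 J2)
  (Prop_irrelevance I3 J3).
Qed.

Definition ideal_le I J := `[< (I : set D) `<=` J >].

Program Definition idealI I J := @Ideal ((I : set D) `&` J)%classic _ _ _.
Next Obligation. by move=> I J; split; exact: ideal0. Qed.
Next Obligation. by move=> I J a b [? ?] [? ?]; split; exact: idealU. Qed.
Next Obligation. by move=> I J a b ba [? ?]; split; exact: ideal_down ba _. Qed.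

Definition ideal_gen (B : set D) : set D :=
  [set c | exists2 s : seq D, (forall a, a \in s -> B a) & c <= \join_(a <- s) a].

Fact ideal_gen0 B : ideal_gen B \bot.
Proof. by exists [::]; rewrite ?big_nil. Qed.
Fact ideal_genU B a b :
  ideal_gen B a -> ideal_gen B b -> ideal_gen B (a `|` b).
Proof.
move=> [s sB sa] [t tB tb]; exists (s ++ t); last by rewrite big_cat leU2.
by move=> x; rewrite mem_cat => /orP[/sB|/tB].
Qed.
Fact ideal_gen_down B a b : b <= a -> ideal_gen B a -> ideal_gen B b.
Proof. by move=> ba [s sB sa]; exists s => //; exact: le_trans sa. Qed.

Definition ideal_bigjoin A : ideal :=
  Ideal (ideal_gen0 (\bigcup_(I in A) (I : set D))) (@ideal_genU _)
    (@ideal_gen_down _).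

Definition idealU_set I J : set D :=
  [set c | exists a b, [/\ (I : set D) a, (J : set D) b & c <= a `|` b]].
Program Definition ideal_join I J := @Ideal (idealU_set I J) _ _ _.
Next Obligation.
by move=> I J; exists \bot, \bot; split=> //; exact: ideal0.
Qed.
Next Obligation.
move=> I J c c' [a [b [Ia Jb cab]]] [a' [b' [Ia' Jb' cab']]].
exists (a `|` a'), (b `|` b'); split; try exact: idealU.
by rewrite joinACA leU2.
Qed.
Next Obligation.
move=> I J a b ba [x [y [Ix Jy xy]]]; exists x, y; split=> //.
exact: le_trans xy.
Qed.

Program Definition down (a : D) := @Ideal [set x | x <= a] _ _ _.
Next Obligation. by move=> a /=; exact: le0x. Qed.
Next Obligation. by move=> a x y /= xa ya; rewrite leUx xa ya. Qed.
Next Obligation. by move=> a x y /= yx; exact: le_trans. Qed.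

Fact ideal_le_refl : reflexive ideal_le.
Proof. by move=> I; exact/asboolP. Qed.
Fact ideal_le_anti : antisymmetric ideal_le.
Proof.
by move=> I J /andP[/asboolP IJ /asboolP JI]; apply/ideal_eqP/seteqP.
Qed.
Fact ideal_le_trans : transitive ideal_le.
Proof.
move=> J I K /asboolP IJ /asboolP JK; apply/asboolP; exact: subset_trans JK.
Qed.

Fact ideal_display : Order.disp_t. Proof. by []. Qed.

HB.instance Definition _ := Order.Le_isPOrder.Build ideal_display ideal
  ideal_le_refl ideal_le_anti ideal_le_trans.

Fact ideal_meetP I J K : (I <= idealI J K) = (I <= J) && (I <= K).
Proof.
apply/asboolP/andP; rewrite /= subsetI.
  by move=> [IJ IK]; split; exact/asboolP.
by move=> [/asboolP IJ /asboolP IK].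
Qed.
Fact ideal_joinP I J K : (ideal_join I J <= K) = (I <= K) && (J <= K).
Proof.
apply/asboolP/andP.
  move=> IJK; split; apply/asboolP => a Xa; apply: IJK.
    by exists a, \bot; split=> //; [exact: ideal0 | rewrite leUl].
  by exists \bot, a; split=> //; [exact: ideal0 | rewrite leUr].
move=> [/asboolP IK /asboolP JK] c [a [b [Ia Jb cab]]].
by apply: ideal_down cab _; apply: idealU; [exact: IK | exact: JK].
Qed.
HB.instance Definition _ := Order.POrder_MeetJoin_isLattice.Build
  ideal_display ideal ideal_meetP ideal_joinP.

Fact ideal_meetUl :
  @left_distributive ideal ideal (@Order.meet _ _) (@Order.join _ _).
Proof.
move=> K I J; apply/ideal_eqP/seteqP; split=> c.
  move=> [[a [b [Ia Jb cab]]] Kc]; exists (a `&` c), (b `&` c).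
  rewrite -meetUl lexI cab lexx; split=> //; split.
  - by apply: ideal_down Ia; exact: leIl.
  - by apply: ideal_down Kc; exact: leIr.
  - by apply: ideal_down Jb; exact: leIl.
  - by apply: ideal_down Kc; exact: leIr.
move=> [a [b [[Ia Ka] [Jb Kb] cab]]]; split; first by exists a, b.
by apply: ideal_down cab _; exact: idealU.
Qed.
HB.instance Definition _ := Order.Lattice_Meet_isDistrLattice.Build
  ideal_display ideal ideal_meetUl.

Fact ideal_le0x I : down \bot <= I.
Proof. by apply/asboolP => x; rewrite /= lex0 => /eqP->; exact: ideal0. Qed.
HB.instance Definition _ := Order.hasBottom.Build ideal_display ideal ideal_le0x.
Fact ideal_lex1 I : I <= down \top.
Proof. by apply/asboolP => x _; exact: lex1. Qed.
HB.instance Definition _ := Order.hasTop.Build ideal_display ideal ideal_lex1.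

Lemma ideal_joins I (s : seq D) : (forall a, a \in s -> (I : set D) a) ->
  (I : set D) (\join_(a <- s) a).
Proof.
move=> sI; rewrite big_seq; apply: big_ind => //; first exact: ideal0.
exact: idealU.
Qed.

Fact ideal_bigjoin_ub A I : A I -> I <= ideal_bigjoin A.
Proof.
move=> AI; apply/asboolP => a Ia; exists [:: a]; last by rewrite big_seq1.
by move=> x; rewrite inE => /eqP->; exists I.
Qed.
Fact ideal_bigjoin_le A I : (forall J, A J -> J <= I) -> ideal_bigjoin A <= I.
Proof.
move=> ub; apply/asboolP => c [s sA cs]; apply: ideal_down cs _.
by apply: ideal_joins => a /sA[J /ub/asboolP]; exact.
Qed.
Fact ideal_meet_bigjoin I A :
  I `&` ideal_bigjoin A = ideal_bigjoin [set I `&` J | J in A].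
Proof.
apply/ideal_eqP/seteqP; split=> c.
  move=> [Ic [s sA cs]]; exists [seq c `&` a | a <- s]; last first.
    suff -> : \join_(a <- [seq c `&` a | a <- s]) a = c `&` \join_(a <- s) a.
      by rewrite lexI lexx.
    by elim: s {sA cs} => [|a s IHs] /=; rewrite ?big_nil ?meetx0 //
      !big_cons IHs meetUr.
  move=> _ /mapP[a /sA[J AJ Ja] ->]; exists (I `&` J); first by exists J.
  by split; [apply: ideal_down Ic; exact: leIl | apply: ideal_down Ja; exact: leIr].
move=> [s sA cs]; split.
  by apply: ideal_down cs _; apply: ideal_joins => a /sA[_ [J _ <-] []].
by exists s => // a /sA[_ [J AJ <-] [_ Ja]]; exists J.
Qed.
HB.instance Definition _ := isFrame.Build ideal_display ideal
  ideal_bigjoin_ub ideal_bigjoin_le ideal_meet_bigjoin.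

Fact down0 : down \bot = \bot. Proof. by []. Qed.
Fact down1 : down \top = \top. Proof. by []. Qed.
Fact downI : {morph down : a b / a `&` b}.
Proof.
move=> a b; apply/ideal_eqP/seteqP; split=> x /=; rewrite lexI => /andP//.
Qed.
Fact downU : {morph down : a b / a `|` b}.
Proof.
move=> a b; apply/ideal_eqP/seteqP; split=> x /=.
  by move=> xab; exists a, b; split=> /=.
by move=> [a' [b' [aa' bb' xab]]]; apply: le_trans xab _; exact: leU2.
Qed.
Fact down_le : {homo down : a b / a <= b}.
Proof. by move=> a b ab; apply/asboolP => x /= /le_trans; exact. Qed.
HB.instance Definition _ := Order.isOrderMorphism.Build _ D _ ideal down down_le.
HB.instance Definition _ := Order.isMeetLatticeMorphism.Build _ D _ ideal down downI.
HB.instance Definition _ := Order.isJoinLatticeMorphism.Build _ D _ ideal down downU.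
HB.instance Definition _ := Order.isBLatticeMorphism.Build _ D _ ideal down down0.
HB.instance Definition _ := Order.isTLatticeMorphism.Build _ D _ ideal down down1.

End Ideals.

Section IdealMap.
Variables (d d' : Order.disp_t) (D : tbDistrLatticeType d).
Variables (E : tbDistrLatticeType d') (f : {dlmorphism D -> E}).
Implicit Types I J : ideal D.

Program Definition ideal_map I : ideal E :=
  @Ideal _ E [set b | exists2 a, (I : set D) a & b <= f a] _ _ _.
Next Obligation. by move=> I; exists \bot; [exact: ideal0 | exact: le0x]. Qed.
Next Obligation.
move=> I b b' [a Ia ba] [a' Ia' ba']; exists (a `|` a'); first exact: idealU.
by rewrite omorphU leU2.
Qed.
Next Obligation.
by move=> I b c cb [a Ia ba]; exists a => //; exact: le_trans ba.
Qed.

Fact ideal_map1 : ideal_map \top = \top.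
Proof.
apply/ideal_eqP/seteqP; split=> x _ /=; first exact: lex1.
by exists \top; [exact: lexx | rewrite omorph1 lex1].
Qed.
Fact ideal_mapI : {morph ideal_map : I J / I `&` J}.
Proof.
move=> I J; apply/ideal_eqP/seteqP; split=> x /=.
  by move=> [a [Ia Ja] xa]; split; exists a.
move=> [[a Ia xa] [b Jb xb]]; exists (a `&` b); last by rewrite omorphI lexI xa.
split; [apply: ideal_down Ia; exact: leIl | apply: ideal_down Jb; exact: leIr].
Qed.
Fact ideal_map_bigjoin A : ideal_map (bigjoin A) = bigjoin (ideal_map @` A).
Proof.
apply/ideal_eqP/seteqP; split=> x /=.
  move=> [a [s sA as_] xa]; exists (map f s); last first.
    apply: le_trans xa _; apply: le_trans (omorph_le f as_) _ => /=.
    elim: s {sA as_} => [|b s IHs] /=; first by rewrite !big_nil omorph0.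
    by rewrite !big_cons omorphU leU2.
  move=> _ /mapP[b /sA[J AJ Jb] ->]; exists (ideal_map J); first by exists J.
  by exists b.
move=> [s sA xs]; suff: (ideal_map (bigjoin A) : set E) x by [].
apply: ideal_down xs _; apply: ideal_joins.
move=> b /sA[_ [J AJ <-] [a Ja ba]]; exists a => //; exact: (asboolW (bigjoin_ub A J AJ)).
Qed.
HB.instance Definition _ := isFrameMorphism.Build _ (ideal D) _ (ideal E)
  ideal_map ideal_map1 ideal_mapI ideal_map_bigjoin.

End IdealMap.

Program Definition ideal_functor : functor DLat Frm :=
  @Functor DLat Frm (fun D => FrmOb (ideal D))
    (fun D E f => ideal_map f : {fmorphism ideal D -> ideal E}) _ _.
Next Obligation.
move=> D; apply: fmorphP => I; apply/ideal_eqP/seteqP; split=> x /=.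
  by move=> [a Ia xa]; exact: ideal_down xa Ia.
by move=> Ix; exists x.
Qed.
Next Obligation.
move=> D E F g f; apply: fmorphP => I; apply/ideal_eqP/seteqP; split=> x /=.
  by move=> [a Ia xa]; exists (f a) => //; exists a.
move=> [b [a Ia ba] xb]; exists a => //; apply: le_trans xb _.
exact: (omorph_le g).
Qed.

Definition forgetful_functor : functor Frm DLat :=
  @Functor Frm DLat (fun L => DLatOb L)
    (fun L M f => f : {dlmorphism L -> M})
    (fun L => dlmorphP (fun=> erefl))
    (fun L M N g f => dlmorphP (fun=> erefl)).

Section IdealJoin.
Variables (d : Order.disp_t) (L : frameType d).
Implicit Types I J : ideal L.

Definition ideal_sup I : L := bigjoin I.

Fact ideal_sup1 : ideal_sup \top = \top.
Proof. by apply/le_anti; rewrite lex1 /=; apply: bigjoin_ub => /=. Qed.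
Fact ideal_supI : {morph ideal_sup : I J / I `&` J}.
Proof.
move=> I J; apply/le_anti/andP; split.
  by rewrite lexI; apply/andP; split; apply: le_bigjoin => x [Ix Jx]; exists x.
rewrite meet_bigjoin; apply/bigjoinP => _ [b Jb <-].
rewrite meetC meet_bigjoin; apply/bigjoinP => _ [a Ia <-].
apply: bigjoin_ub; split.
  by apply: ideal_down Ia; exact: leIr.
by apply: ideal_down Jb; exact: leIl.
Qed.
Fact ideal_sup_bigjoin A : ideal_sup (bigjoin A) = bigjoin (ideal_sup @` A).
Proof.
apply/le_anti/andP; split.
  apply/bigjoinP => x [s sA xs]; apply: le_trans xs _.
  apply/joinsP_seq => a /sA[I AI Ia] _.
  apply: (@le_trans _ _ (ideal_sup I)); first exact: bigjoin_ub.
  by apply: bigjoin_ub; exists I.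
apply/bigjoinP => _ [I AI <-]; apply: le_bigjoin => a Ia; exists a => //.
exact: (asboolW (bigjoin_ub A I AI)).
Qed.
HB.instance Definition _ := isFrameMorphism.Build _ (ideal L) _ L
  ideal_sup ideal_sup1 ideal_supI ideal_sup_bigjoin.

End IdealJoin.

Program Definition ideal_adjunction :
    adjunction ideal_functor forgetful_functor :=
  @Adjunction DLat Frm ideal_functor forgetful_functor
    (@NatTrans DLat DLat (idfunctor DLat)
      (compfunctor forgetful_functor ideal_functor)
      (fun D => @down _ D : {dlmorphism D -> ideal D}) _)
    (@NatTrans Frm Frm
      (compfunctor ideal_functor forgetful_functor) (idfunctor Frm)
      (fun L => @ideal_sup _ L : {fmorphism ideal L -> L}) _)
    _ _.
Next Obligation.
move=> D E f; apply: dlmorphP => a; apply/ideal_eqP/seteqP; split=> x /=.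
  by move=> xfa; exists a.
by move=> [b ba xfb]; apply: le_trans xfb _; exact: (omorph_le f).
Qed.
Next Obligation.
move=> L M f; apply: fmorphP => I /=; rewrite /ideal_sup fmorph_bigjoin.
apply/le_anti/andP; split; apply: le_bigjoin => x.
  by move=> [a Ia xa]; exists (f a) => //; exists a.
by move=> [a Ia <-]; exists (f a) => //; exists a.
Qed.
Next Obligation.
move=> D; apply: fmorphP => I; apply/ideal_eqP/seteqP; split=> x /=.
  move=> [s sI xs]; apply: ideal_down xs _; apply: ideal_joins => a.
  by move=> /sI[J [b Ib Jb] Ja]; apply: ideal_down Ib; exact: (asboolW Jb).
move=> Ix; exists [:: x]; last by rewrite big_seq1.
move=> a; rewrite inE => /eqP->; exists (down x) => //=.
by exists x.
Qed.
Next Obligation.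
move=> L; apply: dlmorphP => a; rewrite /= /ideal_sup.
by apply: bigjoin_unique => // z; apply => /=.
Qed.

(* Functor ideal, comultiplication ideal_map down, counit ideal_sup. *)
Definition ideal_comonad : comonad Frm := comonad_of_adjunction ideal_adjunction.

Lemma ideal_comultE (L : frm) (I : ideal L) :
  (comult ideal_comonad L I : set (ideal L)) =
  [set J | (I : set L) (bigjoin (J : ideal L))].
Proof.
apply/seteqP; split=> J /=.
  move=> [a Ia Ja]; apply: ideal_down Ia; apply/bigjoinP => x.
  exact: (asboolW Ja).
move=> IJ; exists (bigjoin (J : set L)) => //.
by apply/asboolP => x Jx; exact: bigjoin_ub.
Qed.

Section PrimeFilters.
Variables (d : Order.disp_t) (D : tbDistrLatticeType d).

Record prime_filter := PrimeFilter {
  pf_set :> set D;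
  pf1 : pf_set \top;
  pfI : forall a b, pf_set a -> pf_set b -> pf_set (a `&` b);
  pf_up : forall a b, a <= b -> pf_set a -> pf_set b;
  pf0 : ~ pf_set \bot;
  pf_prime : forall a b, pf_set (a `|` b) -> pf_set a \/ pf_set b
}.

HB.instance Definition _ := gen_eqMixin prime_filter.
HB.instance Definition _ := gen_choiceMixin prime_filter.

Lemma pf_eqP (p q : prime_filter) : (p : set D) = q -> p = q.
Proof.
case: p q => p p1 p2 p3 p4 p5 [q q1 q2 q3 q4 q5] /= pq; subst q.
by rewrite (Prop_irrelevance p1 q1) (Prop_irrelevance p2 q2)
  (Prop_irrelevance p3 q3) (Prop_irrelevance p4 q4) (Prop_irrelevance p5 q5).
Qed.

End PrimeFilters.

Section OpenPrimeFilters.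
Variable X : topologicalType.

Definition open_pf := prime_filter (opens X).
HB.instance Definition _ := Choice.on open_pf.

(* The basic open set U^* of the space of prime filters of open sets. *)
Definition star (U : opens X) : set open_pf :=
  [set p | (p : set (opens X)) U].

Lemma star1 : star \top = setT.
Proof. by apply/seteqP; split=> // p _; exact: pf1. Qed.
Lemma star0 : star \bot = set0.
Proof. by apply/seteqP; split=> // p; exact: pf0. Qed.
Lemma starI U V : star (U `&` V) = (star U `&` star V)%classic.
Proof.
apply/seteqP; split=> p; last by move=> [? ?]; exact: pfI.
by move=> pUV; split; apply: pf_up pUV; [exact: leIl | exact: leIr].
Qed.
Lemma starU U V : star (U `|` V) = (star U `|` star V)%classic.
Proof.
apply/seteqP; split=> p; first exact: pf_prime.
by move=> [] pU; apply: pf_up pU; [exact: leUl | exact: leUr].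
Qed.
Lemma star_le U V : U <= V -> star U `<=` star V.
Proof. by move=> UV p; exact: pf_up. Qed.

HB.instance Definition _ := isPointed.Build (opens X) \top.

Fact star_cover : \bigcup_(U in [set: opens X]) star U = setT.
Proof. by apply/seteqP; split=> // p _; exists \top => //; exact: pf1. Qed.
Fact star_join (U V : opens X) (p : open_pf) :
  [set: opens X] U -> [set: opens X] V -> star U p -> star V p ->
  exists W, [/\ [set: opens X] W, star W p & star W `<=` (star U `&` star V)%classic].
Proof.
by move=> _ _ pU pV; exists (U `&` V); rewrite -starI; split=> //; exact: pfI.
Qed.
HB.instance Definition _ := isBaseTopological.Build open_pf star_cover star_join.

Lemma star_open U : open (star U).
Proof. by exists [set U] => //; rewrite bigcup_set1. Qed.
Definition star_opens U : opens open_pf := Opens (star_open U).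

End OpenPrimeFilters.

Lemma continuous_starP (X Y : topologicalType) (f : Y -> open_pf X) :
  (forall U, open (f @^-1` star U)) -> continuous f.
Proof.
move=> fo; apply: continuous_openP => _ [A _ <-].
by rewrite preimage_bigcup; apply: bigcup_open => U _; exact: fo.
Qed.

(* On maps, F f (p) = [set V | f^-1(V) \in p]: under the identification of
   prime filters of a lattice with homomorphisms to 2, this is precomposition
   with f^-1[-]. *)
Section OpenPrimeFilterMap.
Variables (X Y : topologicalType) (f : continuousType X Y).

Program Definition open_pf_map (p : open_pf X) : open_pf Y :=
  @PrimeFilter _ (opens Y) [set V | (p : set (opens X)) (opens_preimage f V)]
    _ _ _ _ _.
Next Obligation. by move=> p; rewrite /= omorph1; exact: pf1. Qed.
Next Obligation. by move=> p U V /= pU pV; rewrite omorphI; exact: pfI. Qed.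
Next Obligation.
by move=> p U V /= UV; apply: pf_up; exact: (omorph_le (opens_preimage f)).
Qed.
Next Obligation. by move=> p; rewrite /= omorph0; exact: pf0. Qed.
Next Obligation. by move=> p U V; rewrite /= omorphU; exact: pf_prime. Qed.

Fact open_pf_map_cts : continuous open_pf_map.
Proof.
by apply: continuous_starP => V; exact: (star_open (opens_preimage f V)).
Qed.
HB.instance Definition _ := isContinuous.Build (open_pf X) (open_pf Y)
  open_pf_map open_pf_map_cts.

End OpenPrimeFilterMap.

Program Definition open_pf_functor : functor Top Top :=
  @Functor Top Top (fun X => open_pf X)
    (fun X Y f => open_pf_map f : continuousType (open_pf X) (open_pf Y)) _ _.
Next Obligation.
move=> X; apply/continuousEP => p; apply/pf_eqP/seteqP.
by split=> U /=; rewrite (_ : opens_preimage _ U = U) //; exact: opens_eqP.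
Qed.
Next Obligation.
move=> X Y Z g f; apply/continuousEP => p; apply/pf_eqP/seteqP.
by split=> U /=; rewrite (_ : opens_preimage _ U =
  opens_preimage f (opens_preimage g U)) //; exact: opens_eqP.
Qed.

Section OpenPrimeFilterMonad.
Variable X : topologicalType.

Program Definition open_pf_unit (x : X) : open_pf X :=
  @PrimeFilter _ (opens X) [set U | (U : set X) x] _ _ _ _ _.
Next Obligation. by []. Qed.
Next Obligation. by []. Qed.
Next Obligation. by move=> x U V /asboolP UV; exact: UV. Qed.
Next Obligation. by move=> x; exact. Qed.
Next Obligation. by []. Qed.

Fact open_pf_unit_cts : continuous open_pf_unit.
Proof. by apply: continuous_starP => U; exact: openP. Qed.
HB.instance Definition _ := isContinuous.Build X (open_pf X) open_pf_unit
  open_pf_unit_cts.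

Program Definition open_pf_mult (P : open_pf (open_pf X)) : open_pf X :=
  @PrimeFilter _ (opens X) [set U | (P : set (opens (open_pf X))) (star_opens U)]
    _ _ _ _ _.
Next Obligation.
move=> P /=; rewrite (_ : star_opens _ = \top); first exact: pf1.
exact/opens_eqP/star1.
Qed.
Next Obligation.
move=> P U V /= PU PV; rewrite (_ : star_opens _ = star_opens U `&` star_opens V).
  exact: pfI.
exact/opens_eqP/starI.
Qed.
Next Obligation.
by move=> P U V UV; apply: pf_up; apply/asboolP; exact: star_le.
Qed.
Next Obligation.
move=> P /=; rewrite (_ : star_opens _ = \bot); first exact: pf0.
exact/opens_eqP/star0.
Qed.
Next Obligation.
move=> P U V /=; rewrite (_ : star_opens _ = star_opens U `|` star_opens V).
  exact: pf_prime.
exact/opens_eqP/starU.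
Qed.

Fact open_pf_mult_cts : continuous open_pf_mult.
Proof.
by apply: continuous_starP => U; exact: (star_open (star_opens U)).
Qed.
HB.instance Definition _ := isContinuous.Build (open_pf (open_pf X)) (open_pf X)
  open_pf_mult open_pf_mult_cts.

End OpenPrimeFilterMonad.

Program Definition open_pf_monad : monad Top :=
  @Monad Top open_pf_functor
    (@NatTrans Top Top (compfunctor open_pf_functor open_pf_functor) _
      (fun X => @open_pf_mult X :
         continuousType (open_pf (open_pf X)) (open_pf X)) _)
    (@NatTrans Top Top (idfunctor Top) _
      (fun X => @open_pf_unit X : continuousType X (open_pf X)) _)
    _ _ _.
Next Obligation.
move=> X Y f; apply/continuousEP => P; apply/pf_eqP/seteqP; split=> U /=;
  by rewrite (_ : opens_preimage _ _ = star_opens (opens_preimage f U)) //;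
  exact: opens_eqP.
Qed.
Next Obligation. by move=> X Y f; apply/continuousEP => x; exact: pf_eqP. Qed.
Next Obligation. by move=> X; apply/continuousEP => p; exact: pf_eqP. Qed.
Next Obligation.
move=> X; apply/continuousEP => p; apply/pf_eqP/seteqP; split=> U /=;
  by rewrite (_ : opens_preimage _ _ = U) //; exact: opens_eqP.
Qed.
Next Obligation.
move=> X; apply/continuousEP => P; apply/pf_eqP/seteqP; split=> U /=;
  by rewrite (_ : opens_preimage _ _ = star_opens (star_opens U)) //;
  exact: opens_eqP.
Qed.

(* Main.v *)
From HB Require Import structures.
From mathcomp Require Import all_boot all_order.
From mathcomp Require Import boolp classical_sets topology.
Require Import Defs.

(* Frame homomorphisms from the ideals of D to 2 correspond to the lattice
   homomorphisms D -> 2, that is to the prime filters of D; the bijection sends p to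
   {a | p(down a) = 1}. For D the opens of X it identifies the open set
   p(down U) = 1 with U^*, and compatibility with the monad structures reduces
   to the naturality of down. *)

Set Implicit Arguments.
Unset Strict Implicit.
Unset Printing Implicit Defensive.

Import Order.TTheory.
Local Open Scope classical_set_scope.
Local Open Scope order_scope.

#[local] Obligation Tactic := idtac.

(** Naturality of the unit [down], elementwise, as a rewriting rule. *)
Lemma ideal_map_down d d' (D : tbDistrLatticeType d) (E : tbDistrLatticeType d')
  (f : {dlmorphism D -> E}) (a : D) : ideal_map f (down a) = down (f a).
Proof.
apply/ideal_eqP/seteqP; split=> x /=; last by move=> xfa; exists a.
by move=> [b ba xfb]; apply: le_trans xfb _; exact: (omorph_le f).
Qed.

Lemma ideal_sup_down d (L : frameType d) (a : L) : ideal_sup (down a) = a.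
Proof. by apply: bigjoin_unique => // z; apply => /=. Qed.

(** This is why a frame homomorphism out of [ideal D] is determined by its values on principal
    ideals. *)
Lemma ideal_bigjoin_down d (D : tbDistrLatticeType d) (I : ideal D) :
  I = bigjoin (@down _ D @` I).
Proof.
apply/le_anti/andP; split; last first.
  apply/bigjoinP => _ [a Ia <-]; apply/asboolP => x /= xa.
  exact: ideal_down xa Ia.
apply/asboolP => a Ia.
suff /asboolW : down a <= bigjoin (@down _ D @` I) by apply => /=.
by apply: bigjoin_ub; exists a.
Qed.

Section PointsOfIdeals.
Variables (d : Order.disp_t) (D : tbDistrLatticeType d).

Program Definition point_pf (p : points (ideal D)) : prime_filter D :=
  @PrimeFilter _ D [set a | p (down a)] _ _ _ _ _.
Next Obligation. by move=> p; rewrite /= omorph1. Qed.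
Next Obligation. by move=> p a b /= pa pb; rewrite !omorphI; exact/andP. Qed.
Next Obligation.
move=> p a b ab /= pa.
have : p (down a) <= p (down b) by exact: (omorph_le p (down_le ab)).
by rewrite pa; case: (p _).
Qed.
Next Obligation. by move=> p; rewrite /= !omorph0. Qed.
Next Obligation. by move=> p a b; rewrite /= !omorphU => /orP. Qed.

Section PointOfPrimeFilter.
Variable q : prime_filter D.

(** The only possible join-preserving extension along [down] of the characteristic function of [q]:
    existence is the join in [bool]. *)
Definition pf_point_fun (I : ideal D) : bool :=
  `[< exists2 a, (I : set D) a & (q : set D) a >].

Fact pf_point_fun1 : pf_point_fun \top = \top.
Proof. by apply/asboolP; exists \top; [exact: lexx | exact: pf1]. Qed.
Fact pf_point_funI : {morph pf_point_fun : I J / I `&` J}.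
Proof.
move=> I J; apply/asboolP/andP => [[a [Ia Ja] qa]|].
  by split; apply/asboolP; exists a.
move=> [/asboolP[a Ia qa] /asboolP[b Jb qb]]; exists (a `&` b); last exact: pfI.
by split; [apply: ideal_down Ia; exact: leIl | apply: ideal_down Jb; exact: leIr].
Qed.
Fact pf_point_fun_bigjoin A :
  pf_point_fun (bigjoin A) = bigjoin (pf_point_fun @` A).
Proof.
apply/asboolP/asboolP => [[a [s sA as_] qa]|[I AI /asboolP[a Ia qa]]].
  (* Since [a] lies below the finite join of [s], that join is in [q]. Primality then selects one of
     its terms, and [pf0] excludes the empty join. *)
  have [b bs qb] : exists2 b, b \in s & (q : set D) b.
    have {qa as_}: (q : set D) (\join_(b <- s) b) by exact: pf_up qa.
    elim: s {sA} => [|b s IHs]; first by rewrite big_nil => /pf0.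
    rewrite big_cons => /pf_prime[qb|/IHs[c cs qc]].
      by exists b => //; rewrite mem_head.
    by exists c => //; rewrite inE cs orbT.
  by have [I AI Ib] := sA b bs; exists I => //; apply/asboolP; exists b.
by exists a => //; exact: (asboolW (bigjoin_ub A I AI)).
Qed.
HB.instance Definition _ := isFrameMorphism.Build _ (ideal D) _ bool
  pf_point_fun pf_point_fun1 pf_point_funI pf_point_fun_bigjoin.

Definition pf_point : points (ideal D) := pf_point_fun.

End PointOfPrimeFilter.

Lemma pf_pointK : cancel pf_point point_pf.
Proof.
move=> q; apply/pf_eqP/seteqP; split=> a /=.
  by move=> /asboolP[b /= ba]; exact: pf_up.
by move=> qa; apply/asboolP; exists a => /=.
Qed.

Lemma point_pfK : cancel point_pf pf_point.
Proof.
move=> p; apply: fmorphP => I.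
rewrite [in RHS](ideal_bigjoin_down I) fmorph_bigjoin.
apply/asboolP/asboolP => [[a Ia pa]|[_ [a Ia <-] pa]]; last by exists a.
by exists (down a) => //; exists a.
Qed.

End PointsOfIdeals.

Section OpenPointsOfIdeals.
Variable X : topologicalType.

(** The topology is carried by [open_pf], not by [prime_filter] over an arbitrary lattice, so
    continuity needs these specialised versions. *)
Definition point_open_pf : points (ideal (opens X)) -> open_pf X := @point_pf _ _.
Definition open_pf_point : open_pf X -> points (ideal (opens X)) := @pf_point _ _.

Fact point_open_pf_cts : continuous point_open_pf.
Proof. by apply: continuous_starP => U; exact: (points_at_open (down U)). Qed.
HB.instance Definition _ := isContinuous.Build (points (ideal (opens X)))
  (open_pf X) point_open_pf point_open_pf_cts.

Fact open_pf_point_cts : continuous open_pf_point.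
Proof.
apply: continuous_openP => _ [I _ <-].
(* The point of [q] takes the value 1 at [I] exactly when [q] meets [I]. *)
rewrite (_ : _ @^-1` _ = \bigcup_(U in (I : set (opens X))) star U).
  by apply: bigcup_open => U _; exact: star_open.
by apply/seteqP; split=> q /asboolP.
Qed.
HB.instance Definition _ := isContinuous.Build (open_pf X)
  (points (ideal (opens X))) open_pf_point open_pf_point_cts.

End OpenPointsOfIdeals.

Program Definition induced_to_open_pf : nattrans
    (induced_monad opens_points_adjunction (monad_of_comonad ideal_comonad))
    open_pf_monad :=
  @NatTrans Top Top _ _ (fun X => @point_open_pf X :
    continuousType (points (ideal (opens X))) (open_pf X)) _.
Next Obligation.
move=> X Y f; apply/continuousEP => p; apply/pf_eqP/funext => V /=.
by rewrite ideal_map_down.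
Qed.

Theorem proposition18 :
  monad_isomorphic
    (induced_monad opens_points_adjunction (monad_of_comonad ideal_comonad))
    open_pf_monad.
Proof.
exists induced_to_open_pf; split=> X.
- exists (@open_pf_point X : continuousType (open_pf X) _).
  by split; apply/continuousEP => q; [exact: point_pfK | exact: pf_pointK].
- apply/continuousEP => x; apply/pf_eqP/funext => U /=.
  (* The induced unit tests whether [x] lies in the join of [down U], which is [U] itself. *)
  by rewrite /nbhd_point_fun ideal_sup_down asboolE.
- apply/continuousEP => P; apply/pf_eqP/funext => U /=.
  (* Both sides become [P] at a principal ideal. The generators agree because the preimage of
     [star U] under [point_open_pf] is [points_at (down U)]. *)
  by rewrite !ideal_map_down; congr (is_true (P (down _))); exact: opens_eqP.
Qed.
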